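(* Let $c<4-2\sqrt{2}$ be a constant. A randomized $c$-competitive online bin packing algorithm must read at least $\Omega(n)$ bits of advice on inputs of length $n$.
   Context: Online bin packing: items with sizes in $(0,1]$ arrive one at a time (the input length $n$ is the number of items) and each must be irrevocably placed into a bin so that the total size in every bin is at most $1$; the cost is the number of bins used. A deterministic algorithm with advice reads bits from an infinite advice tape prepared by an oracle that knows the whole input; its advice complexity is the maximum number of bits read on inputs of length at most $n$. A randomized algorithm with advice complexity $b(n)$ is a probability distribution over deterministic algorithms with advice complexity at most $b(n)$; it is $c$-competitive if there is a constant $\alpha$ with $\mathbb{E}[R(\sigma)]\leq c\,\mathrm{OPT}(\sigma)+\alpha$ for all inputs $\sigma$. *)

(* Defs.v *)
From HB Require Import structures.
From mathcomp Require Import all_boot all_order all_algebra.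
From mathcomp Require Import all_classical all_reals.
From mathcomp Require Import measure lebesgue_measure lebesgue_integral probability.
Set Implicit Arguments. Unset Strict Implicit. Unset Printing Implicit Defensive.
Import Order.TTheory GRing.Theory Num.Theory.
Local Open Scope ring_scope.

Section BinPacking.
Variable R : realType.

Definition valid_input (s : seq R) : bool := all (fun x => (0 < x) && (x <= 1)) s.

Definition valid_packing (s : seq R) (bs : seq nat) : Prop :=
  size bs = size s /\
  forall j : nat, \sum_(p <- zip s bs | p.2 == j) p.1 <= 1.

Definition nbins (bs : seq nat) : nat := size (undup bs).

Definition packable (s : seq R) (m : nat) : Prop :=
  exists bs, valid_packing s bs /\ nbins bs = m.

(** OPT(s): the least number of bins of a valid packing (0 if none exists,
    which only happens for invalid inputs). *)
Definition opt (s : seq R) : nat :=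
  match pselect (exists m, `[< packable s m >]) with
  | left h => ex_minn h
  | right _ => 0%N
  end.

(** A deterministic online algorithm with advice.
    - [da_read seen bits]: after having seen the items [seen] (the last one is
      the current item) and having read the advice bits [bits] so far, does the
      algorithm read one more bit from the tape?
    - [da_place seen bits]: once it stops reading, the bin label where it puts
      the current item.
    - [da_oracle s]: the infinite advice tape prepared by the oracle for the
      whole input [s]. *)
Record det_alg := DetAlg {
  da_read : seq R -> seq bool -> bool;
  da_place : seq R -> seq bool -> nat;
  da_oracle : seq R -> (nat -> bool) }.

Definition tape_prefix (t : nat -> bool) (k : nat) : seq bool := mkseq t k.

Definition next_stop (A : det_alg) (seen : seq R) (t : nat -> bool) (k : nat)
  : option nat :=
  match pselect (exists j, (k <= j)%N && ~~ da_read A seen (tape_prefix t j)) with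
  | left h => Some (ex_minn h)
  | right _ => None
  end.

Fixpoint run_from (A : det_alg) (t : nat -> bool) (seen rest : seq R) (k : nat)
  : option (nat * seq nat) :=
  match rest with
  | [::] => Some (k, [::])
  | x :: rest' =>
      let p := rcons seen x in
      match next_stop A p t k with
      | None => None
      | Some k' =>
          match run_from A t p rest' k' with
          | None => None
          | Some (k'', bs) => Some (k'', da_place A p (tape_prefix t k') :: bs)
          end
      end
  end.

Definition run (A : det_alg) (s : seq R) : option (nat * seq nat) :=
  run_from A (da_oracle A s) [::] s 0.

Definition cost (A : det_alg) (s : seq R) : nat :=
  match run A s with
  | Some (_, bs) => nbins bs
  | None => 0%N
  end.

Definition det_alg_with_advice (A : det_alg) (b : nat -> nat) : Prop :=
  forall s, valid_input s ->
    exists k bs, run A s = Some (k, bs) /\ valid_packing s bs /\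
      (forall n : nat, (size s <= n)%N -> (k <= b n)%N).

End BinPacking.

(** A randomized algorithm with advice complexity [b]: a probability
    distribution (given as a random variable [alg] on a probability space)
    over deterministic algorithms with advice complexity at most [b]. *)
Definition randomized_alg_with_advice {R : realType} {d : measure_display}
  {T : measurableType d} (P : probability T R) (alg : T -> det_alg R)
  (b : nat -> nat) : Prop :=
  (forall w, det_alg_with_advice (alg w) b) /\
  (forall s, measurable_fun setT (fun w => ((cost (alg w) s)%:R : R))).

Definition rand_competitive {R : realType} {d : measure_display}
  {T : measurableType d} (P : probability T R) (alg : T -> det_alg R)
  (c : R) : Prop :=
  exists alpha : R, forall s : seq R, valid_input s ->
    (\int[P]_w ((cost (alg w) s)%:R : R)%:E <= (c * (opt s)%:R + alpha)%:E)%E.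

(* Main.v *)
Require Import Defs.
From HB Require Import structures.
From mathcomp Require Import all_boot all_order all_algebra.
From mathcomp Require Import all_classical all_reals.
From mathcomp Require Import measure lebesgue_measure lebesgue_integral probability.
From mathcomp Require Import exp measurable_realfun.
From mathcomp Require Import ring lra zify.
Import Order.TTheory GRing.Theory Num.Theory.
Local Open Scope ring_scope.
Set Implicit Arguments. Unset Strict Implicit. Unset Printing Implicit Defensive.

(** The hard inputs start with about [p * M] big items of size 9/16, followed by
    [M] medium items slightly below 1/2 chosen by binary search: the bit of a
    medium item is true with probability [p], independently of everything the
    algorithm has seen, and false iff the item is at most the final threshold
    [t]. The input ends with one item of size [1 - t] per false bit. The optimum
    pairs the true items with the big ones and the false items with the final
    ones, using about [M] bins. Online, a medium item opening a new bin wastes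
    that bin if its bit is true, and a second medium item in a bin without big
    item wastes it as well, so that any algorithm spends about [1 - p + 2 theta]
    bins per medium item, up to the gain of the predictable betting strategy
    "bet on the items that open a bin", where [theta = p / (1 + p)]. At
    [p = sqrt 2 - 1] this constant is [4 - 2 sqrt 2]. An algorithm reading [B]
    bits amounts to choosing with hindsight among [2 ^ B] such strategies, which
    gains only [O(B / eta + eta * M)] on average for every small [eta]. *)

(** * Means over independent biased bits *)

Section BiasedCoins.
Variables (R : realType) (p : R).

(** Mean over [n] independent bits, each true with probability [p]. The recursive form lets
    linearity and the exchange with integrals go by induction. *)
Fixpoint Ex (n : nat) (f : seq bool -> R) : R :=
  if n is n'.+1 then
    p * Ex n' (fun w => f (true :: w)) + (1 - p) * Ex n' (fun w => f (false :: w))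
  else f [::].

Lemma Ex_const n (a : R) : Ex n (fun=> a) = a.
Proof. by elim: n => //= n ->; ring. Qed.

Lemma ExD n f g : Ex n (fun w => f w + g w) = Ex n f + Ex n g.
Proof. by elim: n f g => //= n IH f g; rewrite !IH; ring. Qed.

Lemma ExZ n (a : R) f : Ex n (fun w => a * f w) = a * Ex n f.
Proof. by elim: n f => //= n IH f; rewrite !IH; ring. Qed.

Lemma Ex_sum n (I : finType) (f : I -> seq bool -> R) :
  Ex n (fun w => \sum_i f i w) = \sum_i Ex n (f i).
Proof.
elim: n f => //= n IH f.
by rewrite (IH (fun i w => f i (true :: w))) (IH (fun i w => f i (false :: w)))
  big_split /= !mulr_sumr.
Qed.

Lemma Ex_count_false n : Ex n (fun w => (count negb w)%:R) = (1 - p) * n%:R.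
Proof.
elim: n => [|n IH] /=; first by rewrite mulr0.
rewrite IH.
have -> : (fun w => (~~ false + count negb w)%:R : R) =
          (fun w => 1 + (count negb w)%:R).
  by apply/funext => w; rewrite natrD.
by rewrite ExD Ex_const IH -natr1; ring.
Qed.

Hypothesis p01 : 0 <= p <= 1.

Lemma le_Ex n f g : (forall w, size w = n -> f w <= g w) -> Ex n f <= Ex n g.
Proof.
case/andP: p01 => p0 p1.
elim: n f g => [|n IH] f g fg /=; first exact: fg.
by apply: lerD; apply: ler_wpM2l; rewrite ?subr_ge0 //;
  apply: IH => w sw; apply: fg; rewrite /= sw.
Qed.

Lemma ge0_Ex n f : (forall w, 0 <= f w) -> 0 <= Ex n f.
Proof. by move=> f0; rewrite -(Ex_const n 0); apply: le_Ex. Qed.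

(** This is the averaging of Yao's principle: a bound on the random algorithm for each input yields
    a bound on its mean cost over random inputs, with the mean inside the integral. *)
Lemma integral_Ex_le d (T : measurableType d) (P : probability T R) n
    (f : seq bool -> T -> R) (u : seq bool -> R) :
  (forall w, measurable_fun setT (f w)) -> (forall w t, 0 <= f w t) ->
  (forall w, (\int[P]_t (f w t)%:E <= (u w)%:E)%E) ->
  measurable_fun setT (fun t => Ex n (f^~ t)) /\
  (\int[P]_t (Ex n (f^~ t))%:E <= (Ex n u)%:E)%E.
Proof.
case/andP: (p01) => p0 p1.
elim: n f u => [|n IH] f u mf f0 fu /=; first by split.
have [m1 i1] := IH (fun w => f (true :: w)) (fun w => u (true :: w))
  (fun w => mf _) (fun w => f0 _) (fun w => fu _).
have [m2 i2] := IH (fun w => f (false :: w)) (fun w => u (false :: w))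
  (fun w => mf _) (fun w => f0 _) (fun w => fu _).
have q0 : 0 <= 1 - p by rewrite subr_ge0.
have n1 t : 0 <= Ex n (fun w => f (true :: w) t) by apply: ge0_Ex.
have n2 t : 0 <= Ex n (fun w => f (false :: w) t) by apply: ge0_Ex.
split.
  by apply: measurable_funD; apply: measurable_funM => //; exact: measurable_cst.
under eq_integral do rewrite EFinD !EFinM.
rewrite ge0_integralD //=; last 4 first.
- by move=> t _; rewrite mule_ge0 ?lee_fin.
- by apply/measurable_EFinP; apply: measurable_funM.
- by move=> t _; rewrite mule_ge0 ?lee_fin.
- by apply/measurable_EFinP; apply: measurable_funM.
rewrite !ge0_integralZl ?lee_fin //;
  try (by move=> t _; rewrite lee_fin); try exact/measurable_EFinP.
rewrite [leRHS]EFinD [in leRHS]EFinM [in leRHS]EFinM.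
by apply: leeD; apply: lee_wpmul2l; rewrite ?lee_fin.
Qed.

(** [F h] tells whether to bet on the bit that follows the history [h]. *)
Fixpoint gain (F : seq bool -> bool) (w : seq bool) : R :=
  if w is x :: w' then
    (if F [::] then p - x%:R else 0) + gain (fun h => F (x :: h)) w'
  else 0.

(** * Multiplicative betting and the price of hindsight *)

Section Wealth.
Variable eta : R.
Hypothesis eta0 : 0 < eta.
Hypothesis eta2 : eta <= 1 / 2.

(** Capital of a bettor who starts with 1 and stakes the fraction [eta] on each selected bit; its
    logarithm is [eta] times the gain, up to second order. *)
Fixpoint wealth (F : seq bool -> bool) (w : seq bool) : R :=
  if w is x :: w' then
    (if F [::] then 1 + eta * (p - x%:R) else 1) * wealth (fun h => F (x :: h)) w'
  else 1.

(** The bets are fair: [p - x] has mean [p * (p - 1) + (1 - p) * p = 0]. *)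
Lemma Ex_wealth n F : Ex n (wealth F) = 1.
Proof.
elim: n F => //= n IH F; rewrite !ExZ !IH.
by case: (F [::]); ring.
Qed.

Lemma bet_bound (x : bool) : - eta <= eta * (p - x%:R) <= eta.
Proof.
case/andP: p01 => p0 p1.
have h1 := mulr_ge0 (ltW eta0) p0.
have h2 : eta * p <= eta by rewrite ler_piMr // ltW.
by case: x => /=; lra.
Qed.

Lemma wealth_gt0 F w : 0 < wealth F w.
Proof.
elim: w F => //= x w IH F; apply: mulr_gt0 => //.
move: (bet_bound x); set e := eta * _ => /andP[b1 b2]; have e2 := eta2.
by case: (F [::]) => //; lra.
Qed.

(** Applying [ln (1 + y) <= y] to [1 + y = (1 + x)^-1] gives [ln (1 + x) >= x / (1 + x)]; what
    remains amounts to [x ^+ 2 * (1 + 2 * x) >= 0]. *)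
Lemma ln_ge_quadratic (x : R) : - (1 / 2) <= x -> x - 2 * x ^+ 2 <= ln (1 + x).
Proof.
move=> hx; have x1 : 0 < 1 + x by lra.
have := @le_ln1Dx R ((1 + x)^-1 - 1).
have -> : 1 + ((1 + x)^-1 - 1) = (1 + x)^-1 by ring.
rewrite lnV ?posrE // => /(_ _).
have xi : 0 < (1 + x)^-1 by rewrite invr_gt0.
move=> /(_ ltac:(lra)) H.
suff : (1 + x)^-1 - 1 <= - (x - 2 * x ^+ 2) by lra.
rewrite lerBlDr -[leLHS]mul1r ler_pdivrMr //.
have := mulr_ge0 (sqr_ge0 x) (ltac:(lra) : 0 <= 1 + 2 * x); nra.
Qed.

Lemma ln_wealth_ge F w :
  eta * gain F w - 2 * eta ^+ 2 * (size w)%:R <= ln (wealth F w).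
Proof.
elim: w F => [|x w IH] F /=; first by rewrite ln1 !mulr0 subr0.
have [Fh|Fh] := ifP; last first.
  have {}IH := IH (fun h => F (x :: h)).
  rewrite mul1r add0r; apply: le_trans IH; rewrite -natr1; nra.
move: (bet_bound x); set e := eta * (p - _) => /andP[b1 b2]; have e2 := eta2.
have y0 : 0 < 1 + e by lra.
rewrite lnM ?posrE ?wealth_gt0 //.
have H : - (1 / 2) <= e by lra.
have {H} := ln_ge_quadratic H.
have {IH} := IH (fun h => F (x :: h)).
have : e ^+ 2 <= eta ^+ 2.
  by rewrite -subr_ge0 subr_sqr mulr_ge0 //; lra.
rewrite -natr1; have -> : eta * (p - x%:R + gain (fun h => F (x :: h)) w) =
  e + eta * gain (fun h => F (x :: h)) w by rewrite mulrDr.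
lra.
Qed.

(** Even with hindsight, choosing among [#|I|] strategies gains little:
    the tangent of [ln] at [#|I|] bounds the log-wealth of the chosen strategy
    by the total wealth of all strategies, whose mean is [#|I|]. *)
Lemma Ex_gain_le n (I : finType) (F : I -> seq bool -> bool) (a : seq bool -> I) :
  Ex n (fun w => gain (F (a w)) w) <= ln #|I|%:R / eta + 2 * eta * n%:R.
Proof.
set K : R := #|I|%:R.
have K0 : 0 < K.
  by rewrite ltr0n; apply/card_gt0P; exists (a [::]).
pose rhs w : R := eta^-1 * (K^-1 * (\sum_i wealth (F i) w)) +
                  ((ln K - 1) / eta + 2 * eta * n%:R).
have : Ex n (fun w => gain (F (a w)) w) <= Ex n rhs.
  apply: le_Ex => w sw; rewrite /rhs.
  have := ln_wealth_ge (F (a w)) w; rewrite sw.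
  have W0 := wealth_gt0 (F (a w)) w.
  have L : ln (wealth (F (a w)) w) <= K^-1 * wealth (F (a w)) w - 1 + ln K.
    have := @le_ln1Dx R (K^-1 * wealth (F (a w)) w - 1).
    have Y0 : 0 < K^-1 * wealth (F (a w)) w by rewrite mulr_gt0 ?invr_gt0.
    rewrite [1 + (_ - 1)]addrC subrK lnM ?posrE ?invr_gt0 // lnV ?posrE //.
    move=> /(_ ltac:(lra)); lra.
  have S : wealth (F (a w)) w <= \sum_i wealth (F i) w.
    rewrite (bigD1 (a w)) //= lerDl sumr_ge0 // => i _.
    exact/ltW/wealth_gt0.
  have {}S : K^-1 * wealth (F (a w)) w <= K^-1 * \sum_i wealth (F i) w.
    by rewrite ler_wpM2l // invr_ge0 ltW.
  move=> G.
  have -> : eta^-1 * (K^-1 * \sum_i wealth (F i) w) +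
            ((ln K - 1) / eta + 2 * eta * n%:R) =
            (K^-1 * (\sum_i wealth (F i) w) + ln K - 1 + 2 * eta ^+ 2 * n%:R) / eta.
    by field; rewrite ?gt_eqF.
  by rewrite ler_pdivlMr //; lra.
move=> /le_trans; apply; rewrite /rhs ExD !ExZ Ex_const Ex_sum.
under eq_bigr do rewrite Ex_wealth.
rewrite sumr_const mulVf ?gt_eqF //.
by rewrite le_eqVlt; apply/orP; left; apply/eqP; field; rewrite ?gt_eqF.
Qed.

End Wealth.
End BiasedCoins.

(** * Packings and the hard inputs *)

Section Packings.
Variable R : realType.
Implicit Types (s : seq R) (bs J : seq nat) (w : seq bool).

Lemma nbins_ge bs J : uniq J -> {in J, forall i, (i < size bs)%N} ->
  {in J &, injective (nth 0%N bs)} -> (size J <= nbins bs)%N.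
Proof.
move=> uJ ltJ injJ; rewrite -(size_map (nth 0%N bs)); apply: uniq_leq_size.
  by rewrite map_inj_in_uniq.
by move=> _ /mapP[i iJ ->]; rewrite mem_undup mem_nth ?ltJ.
Qed.

Lemma bin_load_le1 s bs (l : nat) J : valid_packing s bs -> all (>= 0) s ->
  uniq J -> {in J, forall i, (i < size s)%N /\ nth 0%N bs i = l} ->
  \sum_(i <- J) s`_i <= 1.
Proof.
move=> [sb /(_ l) load] /allP s0 uJ hJ; apply: le_trans load.
rewrite (big_nth (0, 0%N)) size_zip sb minnn.
rewrite [leRHS](eq_big (fun i => nth 0%N bs i == l) (fun i => s`_i)); last 2 first.
- by move=> i; rewrite nth_zip.
- by move=> i _; rewrite nth_zip.
rewrite (_ : \sum_(i <- J) s`_i = \sum_(0 <= i < size s | i \in J) s`_i).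
  rewrite big_seq_cond [leRHS]big_seq_cond [leLHS]big_mkcond [leRHS]big_mkcond.
  apply: ler_sum => i _; rewrite mem_index_iota /=.
  case: ltnP => //= i_s; case: ifP => [/hJ[_ ->]|_]; first by rewrite eqxx.
  by case: ifP => // _; rewrite s0 ?mem_nth.
rewrite -[RHS]big_filter; apply: perm_big; apply: uniq_perm => //.
  by rewrite filter_uniq ?iota_uniq.
move=> i; rewrite mem_filter mem_index_iota /=.
by case iJ: (i \in J) => //=; have [->] := hJ _ iJ.
Qed.

(** Binary search in the interval from [lo] to [lo + 2 * h]: each item is the midpoint, and its bit
    then keeps the lower half if true and the upper half if false. *)
Fixpoint mids (lo h : R) w : seq R :=
  if w is x :: w' then lo + h :: mids (if x then lo else lo + h) (h / 2) w'
  else [::].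

Fixpoint threshold (lo h : R) w : R :=
  if w is x :: w' then threshold (if x then lo else lo + h) (h / 2) w' else lo.

Lemma size_mids lo h w : size (mids lo h w) = size w.
Proof. by elim: w lo h => //= x w IH lo h; rewrite IH. Qed.

(** An item is issued before its own bit is used, so an online algorithm sees it without learning
    that bit. *)
Lemma mids_prefix lo h w w' i : (i < size w)%N -> (i < size w')%N ->
  take i w = take i w' -> take i.+1 (mids lo h w) = take i.+1 (mids lo h w').
Proof.
elim: w w' i lo h => [|x w IH] [|x' w'] [|i] //= lo h iw iw'.
  by rewrite !take0.
by move=> [<- /IH] ->.
Qed.

Lemma threshold_bounds lo h w : 0 < h -> lo <= threshold lo h w < lo + 2 * h.
Proof.
elim: w lo h => [|x w IH] lo h h0 /=; first by lra.
have /andP[] := IH (if x then lo else lo + h) (h / 2) ltac:(lra).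
by case: (x) => t1 t2; apply/andP; split; lra.
Qed.

Lemma mids_bounds lo h w i : 0 < h -> (i < size w)%N ->
  lo < (mids lo h w)`_i < lo + 2 * h.
Proof.
elim: w lo h i => [|x w IH] lo h [|i] //= h0 iw; first by lra.
have /andP[] := IH (if x then lo else lo + h) (h / 2) i ltac:(lra) iw.
by case: (x) => t1 t2; apply/andP; split; lra.
Qed.

Lemma mids_threshold lo h w i : 0 < h -> (i < size w)%N ->
  if nth false w i then threshold lo h w < (mids lo h w)`_i
  else (mids lo h w)`_i <= threshold lo h w.
Proof.
elim: w lo h i => [|x w IH] lo h [|i] //= h0 iw; last by apply: IH => //; lra.
have /andP[] := threshold_bounds (if x then lo else lo + h) w (ltac:(lra) : 0 < h / 2).
by case: (x) => //=; lra.
Qed.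

(** The sizes lie between 3/8 and 7/16: above 1/3, so that no three items share a bin, and at most 1
    - 9/16, so that each fits with a big item. *)
Definition medium w := mids (3 / 8) (1 / 32) w.

Definition thr w := threshold (3 / 8) (1 / 32) w.

(** A medium item fits with a big item of size 9/16; it fits with a final item
    of size [1 - thr w] iff its bit is false, i.e. iff it is at most [thr w]. *)
Definition input (m : nat) w : seq R :=
  nseq m (9 / 16) ++ medium w ++ nseq (count negb w) (1 - thr w).

Lemma thr_bounds w : 3 / 8 <= thr w < 7 / 16.
Proof.
have /andP[] := threshold_bounds (3 / 8) w (ltac:(lra) : (0 : R) < 1 / 32).
rewrite /thr => *; apply/andP; split; lra.
Qed.

Lemma medium_bounds w i : (i < size w)%N -> 3 / 8 < (medium w)`_i < 7 / 16.
Proof.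
move=> iw.
have /andP[] := mids_bounds (3 / 8) (ltac:(lra) : (0 : R) < 1 / 32) iw.
rewrite /medium => *; apply/andP; split; lra.
Qed.

Lemma medium_thr w i : (i < size w)%N ->
  if nth false w i then thr w < (medium w)`_i else (medium w)`_i <= thr w.
Proof. by apply: mids_threshold; lra. Qed.

Lemma size_input m w : size (input m w) = (m + (size w + count negb w))%N.
Proof. by rewrite !size_cat !size_nseq size_mids. Qed.

Lemma nth_input_big m w i : (i < m)%N -> (input m w)`_i = 9 / 16.
Proof. by move=> im; rewrite nth_cat size_nseq im nth_nseq im. Qed.

Lemma nth_input_medium m w i : (i < size w)%N ->
  (input m w)`_(m + i) = (medium w)`_i.
Proof.
move=> iw; rewrite nth_cat size_nseq ltnNge leq_addr /= addKn.
by rewrite nth_cat size_mids iw.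
Qed.

Lemma nth_input_final m w i : (m + size w <= i < size (input m w))%N ->
  (input m w)`_i = 1 - thr w.
Proof.
rewrite size_input => /andP[i1 i2]; rewrite nth_cat size_nseq.
have -> : (i < m)%N = false by lia.
rewrite nth_cat size_mids.
have -> : (i - m < size w)%N = false by lia.
by rewrite nth_nseq ifT //; lia.
Qed.

Lemma input_gt m w i : (i < size (input m w))%N -> 3 / 8 < (input m w)`_i.
Proof.
move=> isz; have [im|mi] := ltnP i m; first by rewrite nth_input_big //; lra.
have [iw|wi] := ltnP i (m + size w).
  have iw' : (i - m < size w)%N by lia.
  by rewrite -(subnKC mi) nth_input_medium //; have /andP[] := medium_bounds iw'.
rewrite nth_input_final ?wi //; have /andP[] := thr_bounds w; lra.
Qed.

Lemma input_valid m w : valid_input (input m w).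
Proof.
have /andP[t1 t2] := thr_bounds w.
rewrite /valid_input !all_cat !all_nseq; apply/and3P; split.
- by apply/orP; right; lra.
- apply/(all_nthP 0) => i; rewrite size_mids => /medium_bounds/andP[*].
  by apply/andP; split; lra.
- by apply/orP; right; apply/andP; split; lra.
Qed.

Definition fresh bs i := nth 0%N bs i \notin take i bs.

(** * Two lower bounds on the bins of a packing *)

Section LowerBound.
Variables (m : nat) (w : seq bool) (bs : seq nat).
Hypothesis bs_valid : valid_packing (input m w) bs.

Let N := size (input m w).

Let size_bs : size bs = N. Proof. by case: bs_valid. Qed.

Let input_ge0 : all (>= 0) (input m w).
Proof. by apply/(all_nthP 0) => i /input_gt; lra. Qed.

Lemma two_items i j : (i < j < N)%N -> nth 0%N bs i = nth 0%N bs j ->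
  (input m w)`_i + (input m w)`_j <= 1.
Proof.
move=> /andP[ij jN] eq_ij.
have := @bin_load_le1 _ _ (nth 0%N bs i) [:: i; j] bs_valid input_ge0.
rewrite !big_cons big_nil addr0; apply.
  by rewrite /= inE neq_ltn ij.
by move=> k; rewrite !inE => /orP[] /eqP->; split=> //; apply: ltn_trans jN.
Qed.

Lemma no_three_items i j k : (i < j < k)%N -> (k < N)%N ->
  nth 0%N bs i = nth 0%N bs j -> nth 0%N bs j <> nth 0%N bs k.
Proof.
move=> /andP[ij jk] kN eq_ij eq_jk.
have jN := ltn_trans jk kN; have iN := ltn_trans ij jN.
have := @bin_load_le1 _ _ (nth 0%N bs j) [:: i; j; k] bs_valid input_ge0.
rewrite !big_cons big_nil addr0.
have := input_gt iN; have := input_gt jN; have := input_gt kN.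
move=> gi gj gk H.
suff : (input m w)`_i + ((input m w)`_j + (input m w)`_k) <= 1 by lra.
apply: H; first by rewrite /= !inE negb_or !neq_ltn ij jk (ltn_trans ij jk).
by move=> l; rewrite !inE => /or3P[] /eqP->.
Qed.

Lemma filter_nbins (Q : pred nat) :
  (forall i j, (i < j < N)%N -> Q i -> Q j -> nth 0%N bs i <> nth 0%N bs j) ->
  (count Q (iota 0 N) <= nbins bs)%N.
Proof.
move=> QP; rewrite -size_filter; apply: nbins_ge.
- by rewrite filter_uniq ?iota_uniq.
- by move=> i; rewrite mem_filter mem_iota size_bs => /and3P[].
move=> i j; rewrite !mem_filter !mem_iota => /and3P[Qi _ iN] /and3P[Qj _ jN] e.
have [ij|ji|//] := ltngtP i j.
- by case: (QP i j) => //; rewrite ij.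
- by case: (QP j i) => //; rewrite ji.
Qed.

Let count_split (Q : pred nat) : count Q (iota 0 N) =
  (count Q (iota 0 m) + (count (fun i => Q (m + i)%N) (iota 0 (size w)) +
   count Q (iota (m + size w) (count negb w))))%N.
Proof.
rewrite /N size_input !iotaD !count_cat add0n; congr (_ + (_ + _))%N.
by rewrite -{1}(addn0 m) iotaDl count_map.
Qed.

(** The counted items lie in distinct bins: big and final items all exceed 1/2, a true medium item
    exceeds [thr w] and so fits with no final item, and an item opening a bin joins no earlier
    one. *)
Lemma nbins_ge_fresh_large :
  (m + count (fun i => fresh bs (m + i) && nth false w i) (iota 0 (size w))
     + count negb w <= nbins bs)%N.
Proof.
pose Q i := [|| (i < m)%N, (m + size w <= i)%N | fresh bs i && nth false w (i - m)].
suff /(leq_trans _) : (count Q (iota 0 N) <= nbins bs)%N.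
  apply; rewrite count_split -!addnA; apply: leq_add; last apply: leq_add.
  - rewrite (eq_in_count (a1 := Q) (a2 := predT)) ?count_predT ?size_iota //.
    by move=> i; rewrite mem_iota /Q => /andP[_ ->].
  - by apply: sub_count => i; rewrite /Q addKn => ->; rewrite !orbT.
  - rewrite (eq_in_count (a1 := Q) (a2 := predT)) ?count_predT ?size_iota //.
    by move=> i; rewrite mem_iota /Q => /andP[-> _]; rewrite orbT.
apply: filter_nbins => i j /andP[ij jN] Qi Qj eq_ij.
have /andP[t1 t2] := thr_bounds w.
have iN := ltn_trans ij jN.
have ij2 : (input m w)`_i + (input m w)`_j <= 1 by apply: two_items; rewrite ?ij.
have [jm|mj] := ltnP j m.
  by move: ij2; rewrite !nth_input_big //; [lra | lia].
have [jw|wj] := ltnP j (m + size w).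
  have : fresh bs j by move: Qj; rewrite /Q; case/or3P => [||/andP[]//]; lia.
  rewrite /fresh -eq_ij -(nth_take 0%N ij) mem_nth // size_take size_bs jN //.
move: ij2; rewrite (@nth_input_final m w j) ?wj //.
have [im|mi] := ltnP i m; first by rewrite nth_input_big //; lra.
have [iw|wi] := ltnP i (m + size w); last first.
  by rewrite nth_input_final ?wi //; lra.
have iw' : (i - m < size w)%N by lia.
have := medium_thr iw'; rewrite -(nth_input_medium m iw') subnKC //.
have -> : nth false w (i - m).
  by move: Qi; rewrite /Q; case/or3P => [||/andP[]//]; lia.
lra.
Qed.

(** Medium items that open no bin and final items lie in distinct bins: two final items are too
    large together, and a medium item that joins an earlier item leaves no room for a third. *)
Lemma nbins_ge_stale :
  (size w + count negb w <=
   nbins bs + count (fun i => fresh bs (m + i)) (iota 0 (size w)))%N.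
Proof.
pose Q i := (m + size w <= i)%N || (m <= i)%N && ~~ fresh bs i.
suff QN : (count Q (iota 0 N) <= nbins bs)%N.
  rewrite -{1}(size_iota 0 (size w)).
  rewrite -(count_predC (fun i => fresh bs (m + i)) (iota 0 (size w))).
  rewrite -addnA addnC leq_add2r; apply: leq_trans QN.
  rewrite count_split; apply: leq_trans (leq_addl _ _); apply: leq_add.
    by apply: sub_count => i; rewrite /Q leq_addr /= => ->; rewrite orbT.
  rewrite (eq_in_count (a1 := Q) (a2 := predT)) ?count_predT ?size_iota //.
  by move=> i; rewrite mem_iota /Q => /andP[-> _].
apply: filter_nbins => i j /andP[ij jN] Qi Qj eq_ij.
have [wi|iw] := leqP (m + size w) i.
  have := @two_items i j; rewrite ij jN => /(_ isT eq_ij).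
  rewrite !nth_input_final ?wi ?jN ?(ltn_trans ij jN) ?(leq_trans wi (ltnW ij)) //.
  by have /andP[] := thr_bounds w; lra.
have : ~~ fresh bs i by move: Qi; rewrite /Q leqNgt iw => /andP[].
rewrite negbK => /(nthP 0%N)[k]; rewrite size_take size_bs (ltn_trans ij jN).
move=> ki; rewrite nth_take // => eq_ki.
have kij : (k < i < j)%N by rewrite ki.
exact: no_three_items kij jN eq_ki eq_ij.
Qed.

End LowerBound.

(** Expresses the gain through the counts that occur in the two packing bounds. *)
Lemma gain_count (p : R) F f w :
  (forall i, (i < size w)%N -> F (take i w) = f i) ->
  gain p F w = p * (count f (iota 0 (size w)))%:R -
    (count (fun i => f i && nth false w i) (iota 0 (size w)))%:R.
Proof.
elim: w F f => [|x w IH] F f Ff /=; first by rewrite mulr0 subr0.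
rewrite (IH _ (f \o succn)); last by move=> i iw; apply: (Ff i.+1).
have := Ff 0%N isT; rewrite take0 => ->.
have shift (g : pred nat) n : count g (iota 1 n) = count (g \o succn) (iota 0 n).
  by rewrite -[1%N]addn0 iotaDl count_map; apply: eq_count => i /=; rewrite add1n.
rewrite !{}shift.
by rewrite !natrD; case: (f 0%N); case: (x) => /=; ring.
Qed.

End Packings.

(** * Locality of runs in the tape and in the input *)

Section Runs.
Variables (R : realType) (A : det_alg R).
Implicit Types (t : nat -> bool) (seen rest : seq R) (k n : nat).

Lemma next_stopP seen t k j : next_stop A seen t k = Some j <->
  [/\ (k <= j)%N, ~~ da_read A seen (tape_prefix t j) &
      forall i, (k <= i)%N -> ~~ da_read A seen (tape_prefix t i) -> (j <= i)%N].
Proof.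
rewrite /next_stop; case: pselect => [ex|nex]; last first.
  by split=> // -[kj rj _]; case: nex; exists j; rewrite kj.
case: ex_minnP => j' /andP[kj' rj'] minj'; split=> [[<-]|[kj rj minj]].
  by split=> // i ki ri; apply: minj'; rewrite ki.
by congr Some; apply/eqP; rewrite eqn_leq minj // minj' // kj.
Qed.

Lemma run_from_ge t seen rest k k' bs :
  run_from A t seen rest k = Some (k', bs) -> (k <= k')%N.
Proof.
elim: rest seen k k' bs => [|x rest IH] seen k k' bs /=; first by case=> ->.
case E: next_stop => [j|//]; case E': run_from => [[j' bs']|//] [<- _].
by have /next_stopP[kj _ _] := E; apply: leq_trans kj (IH _ _ _ _ E').
Qed.

(** Only the first [k'] bits of the tape are inspected, so a finite advice string can stand for the
    infinite tape. *)
Lemma run_from_agree t t' seen rest k k' bs :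
  run_from A t seen rest k = Some (k', bs) -> (forall i, (i < k')%N -> t i = t' i) ->
  run_from A t' seen rest k = Some (k', bs).
Proof.
move=> + tt'.
have pre i : (i <= k')%N -> tape_prefix t' i = tape_prefix t i.
  move=> ik'; apply/esym/eq_in_map => l; rewrite mem_iota => /andP[_ li].
  exact/tt'/(leq_trans li).
elim: rest seen k bs => [|x rest IH] seen k bs //=.
case E: next_stop => [j|//]; case E': run_from => [[j' bs']|//] [jk' <-].
move: E'; rewrite jk' => E'; have jk := run_from_ge E'.
have /next_stopP[kj rj minj] := E.
have -> : next_stop A (rcons seen x) t' k = Some j.
  apply/next_stopP; split=> [//||i ki]; first by rewrite pre.
  have [ij|//] := ltnP i j; rewrite pre ?(leq_trans (ltnW ij)) // => ri.
  by have := minj i ki ri; rewrite leqNgt ij.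
by rewrite (IH _ _ _ E') pre.
Qed.

Lemma run_from_take n t seen rest k k' bs :
  run_from A t seen rest k = Some (k', bs) ->
  exists k1, run_from A t seen (take n rest) k = Some (k1, take n bs).
Proof.
elim: n seen rest k bs => [|n IH] seen [|x rest] k bs /=.
- by case=> _ <-; exists k.
- by move=> _; exists k; rewrite take0.
- by case=> _ <-; exists k.
case E: next_stop => [j|//]; case E': run_from => [[j' bs']|//] [jk' <-].
by have [|k1 ->] := IH (rcons seen x) rest j bs'; [rewrite E' jk'|exists k1].
Qed.

End Runs.

(** * From online algorithms to betting strategies *)

Section Strategy.
Variable R : realType.
Implicit Types (w h : seq bool) (bs : seq nat).

Lemma input_prefix m w w' i : (i < size w)%N -> (i < size w')%N ->
  take i w = take i w' ->
  take (m + i).+1 (input R m w) = take (m + i).+1 (input R m w').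
Proof.
move=> iw iw' eq_i; rewrite /input ![take _ (nseq _ _ ++ _)]take_cat size_nseq -addnS ltnNge leq_addr /=.
rewrite addKn !takel_cat ?size_mids //; congr (_ ++ _).
exact: mids_prefix.
Qed.

Lemma fresh_take bs i : fresh (take i.+1 bs) i = fresh bs i.
Proof. by rewrite /fresh nth_take // take_takel. Qed.

(** Whether [A] with advice [a] puts the medium item that follows the history
    [h] in an empty bin. That item does not depend on its own bit. *)
Definition opens (A : det_alg R) m (a h : seq bool) : bool :=
  if run_from A (nth false a) [::] (take (m + size h).+1 (input R m (rcons h true))) 0
    is Some (_, bs) then fresh bs (m + size h) else false.

(** Average of [nbins_ge_fresh_large] and [nbins_ge_stale] with weights [1 - theta] and [theta].
    Since [(1 - theta) * p = theta], the terms counting opened bins combine into a multiple of the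
    gain. *)
Lemma cost_ge (A : det_alg R) b m n w (p theta : R) :
  det_alg_with_advice A b -> (size (input R m w) <= n)%N ->
  0 <= theta <= 1 -> (1 - theta) * p = theta ->
  (count negb w)%:R + theta * (size w)%:R + (1 - theta) * m%:R -
    (1 - theta) * gain p (opens A m (mkseq (da_oracle A (input R m w)) (b n))) w
  <= (cost A (input R m w))%:R.
Proof.
move=> advA sn /andP[th0 th1] thp.
have [k [bs [runA [pbs kb]]]] := advA _ (input_valid R m w).
have {}kb := kb _ sn.
rewrite /cost runA.
set a := mkseq _ _.
(* Past its [b n] bits the string is padded with [false]; the run never reads that far. *)
have run_a : run_from A (nth false a) [::] (input R m w) 0 = Some (k, bs).
  apply: run_from_agree runA _ => i ik.
  by rewrite nth_mkseq // (leq_trans ik).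
(* Changing bit [i] and dropping the items after medium item [i] does not affect its placement, so
   the history alone decides it. *)
have op i : (i < size w)%N -> opens A m a (take i w) = fresh bs (m + i).
  move=> iw; rewrite /opens size_takel ?(ltnW iw) //.
  rewrite (@input_prefix m _ w) //; last 2 first.
  - by rewrite size_rcons size_takel // ltnW.
  - by rewrite -cats1 take_cat size_takel ?(ltnW iw) // ltnn subnn take0 cats0.
  have [k1 ->] := run_from_take (m + i).+1 run_a.
  by rewrite fresh_take.
rewrite (gain_count _ op).
have := nbins_ge_fresh_large pbs; have := nbins_ge_stale pbs.
set f := count (fun i => fresh bs _) _; set fL := count (fun i => _ && _) _.
rewrite -!(ler_nat R) !natrD => L2 L1.
have := ler_wpM2l th0 L2.
have := ler_wpM2l (ltac:(lra) : 0 <= 1 - theta) L1.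
have : (1 - theta) * p * f%:R = theta * f%:R by rewrite thp.
lra.
Qed.

(** * Upper bound on the optimum of a hard input *)

Lemma opt_le (s : seq R) bs : valid_packing s bs -> (opt s <= nbins bs)%N.
Proof.
move=> pbs; have ex : exists l, `[< packable s l >].
  by exists (nbins bs); apply/asboolP; exists bs.
rewrite /opt; case: pselect => // ex'; case: ex_minnP => l _; apply.
by apply/asboolP; exists bs.
Qed.

Lemma nbins_le bs n : all (fun i => i < n)%N bs -> (nbins bs <= n)%N.
Proof.
move=> /allP bsn; rewrite -[leqRHS](size_iota 0); apply: uniq_leq_size.
  exact: undup_uniq.
by move=> i; rewrite mem_undup mem_iota => /bsn.
Qed.

(** Distinct labels put at most one item into bin [j]; [0 <= c] covers the empty bin. *)
Lemma load_uniq_le (s : seq R) bs j (c : R) : 0 <= c -> uniq bs ->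
  (forall i, (i < size s)%N -> (i < size bs)%N -> nth 0%N bs i = j -> s`_i <= c) ->
  \sum_(x <- zip s bs | x.2 == j) x.1 <= c.
Proof.
move=> c0; elim: s bs => [|x s IH] [|y bs] /=; rewrite ?big_nil //.
move=> /andP[ybs ubs] sc; rewrite big_cons /=.
have [yj|yj] := eqVneq y j; last first.
  by apply: IH => // i i1 i2; apply: (sc i.+1).
rewrite big1_seq ?addr0; first exact: (sc 0%N).
move=> z /andP[/eqP zj] /(nthP z)[i] isz zi.
have : z.2 \in bs.
  rewrite -zi nth_zip_cond isz /= mem_nth //.
  by move: isz; rewrite size_zip leq_min => /andP[].
by rewrite zj -yj (negPf ybs).
Qed.


Fixpoint labels w r q : seq nat :=
  if w is x :: w' then
    if x then r :: labels w' r.+1 q else q :: labels w' r q.+1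
  else [::].

Lemma size_labels w r q : size (labels w r q) = size w.
Proof. by elim: w r q => // -[] w IH r q /=; rewrite IH. Qed.

Lemma labels_bounds w r q i : (i < size w)%N ->
  if nth false w i then (r <= nth 0%N (labels w r q) i < r + count id w)%N
  else (q <= nth 0%N (labels w r q) i < q + count negb w)%N.
Proof.
elim: w r q i => [|[] w IH] r q [|i] //= iw; try lia.
- by have := IH r.+1 q i iw; case: (nth false w i); lia.
- by have := IH r q.+1 i iw; case: (nth false w i); lia.
Qed.

Lemma labels_uniq w r q : (r + count id w <= q)%N -> uniq (labels w r q).
Proof.
elim: w r q => [|[] w IH] r q //= rq; rewrite IH ?andbT; try lia.
- apply/negP => /(nthP 0%N)[i]; rewrite size_labels => iw e.
  by have := labels_bounds r.+1 q iw; rewrite e; case: (nth false w i); lia.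
- apply/negP => /(nthP 0%N)[i]; rewrite size_labels => iw e.
  by have := labels_bounds r q.+1 iw; rewrite e; case: (nth false w i); lia.
Qed.

(** Bins below [K] take at most one big and one true medium item each, the next [S] bins one false
    medium and one final item each. *)
Lemma opt_input_le m w :
  (opt (input R m w) <= maxn m (count id w) + count negb w)%N.
Proof.
set K := maxn m _; set S := count negb w.
pose bs := iota 0 m ++ labels w 0 K ++ iota K S.
have mK : (m <= K)%N by rewrite leq_maxl.
have LK : (0 + count id w <= K)%N by rewrite leq_maxr.
have ub := labels_uniq LK.
have /andP[t1 t2] := thr_bounds R w.
suff pbs : valid_packing (input R m w) bs.
  apply: leq_trans (opt_le pbs) _; apply: nbins_le.
  rewrite !all_cat; apply/and3P; split; apply/allP => i.
  - by rewrite mem_iota; lia.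
  - move=> /(nthP 0%N)[l]; rewrite size_labels => lw <- /=.
    by have := labels_bounds 0 K lw; case: (nth false w l); lia.
  - by rewrite mem_iota; lia.
split=> [|j].
  by rewrite size_input !size_cat !size_iota size_labels.
rewrite /input !zip_cat ?size_nseq ?size_iota ?size_mids ?size_labels //.
rewrite !big_cat /=.
have big_load (c : R) : 0 <= c -> ((j < m)%N -> 9 / 16 <= c) ->
    \sum_(x <- zip (nseq m (9 / 16)) (iota 0 m) | x.2 == j) x.1 <= c.
  move=> c0 jc; apply: load_uniq_le => //; first exact: iota_uniq.
  move=> i; rewrite size_nseq => im _; rewrite nth_iota // => ij.
  by rewrite nth_nseq im jc // -ij.
have final_load (c : R) : 0 <= c -> ((K <= j)%N -> 1 - thr R w <= c) ->
    \sum_(x <- zip (nseq S (1 - thr R w)) (iota K S) | x.2 == j) x.1 <= c.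
  move=> c0 jc; apply: load_uniq_le => //; first exact: iota_uniq.
  move=> i; rewrite size_nseq => iS _; rewrite nth_iota // => ij.
  by rewrite nth_nseq iS jc // -ij leq_addr.
have medium_load (c : R) : 0 <= c -> ((j < K)%N -> 7 / 16 <= c) ->
    ((K <= j)%N -> thr R w <= c) ->
    \sum_(x <- zip (medium R w) (labels w 0 K) | x.2 == j) x.1 <= c.
  move=> c0 jc jc'; apply: load_uniq_le => // i; rewrite size_mids => iw _ ij.
  have := labels_bounds 0 K iw; have := medium_thr R iw; rewrite ij.
  have /andP[_ b2] := medium_bounds R iw.
  case: (nth false w i) => h /andP[jl jr].
    by apply: le_trans (ltW b2) (jc _); apply: leq_trans jr LK.
  exact: le_trans h (jc' jl).
(* The loads are at most [9 / 16 + 7 / 16] below [K], and [thr R w + (1 - thr R w)] from [K] on. *)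
have [jK|Kj] := ltnP j K.
  have := big_load (9 / 16) ltac:(lra) (fun=> lexx _).
  have := medium_load (7 / 16) ltac:(lra) (fun=> lexx _) ltac:(lia).
  have := final_load 0 (lexx _) ltac:(lia).
  lra.
have := big_load 0 (lexx _) ltac:(lia).
have := medium_load (thr R w) ltac:(lra) ltac:(lia) (fun=> lexx _).
have := final_load (1 - thr R w) ltac:(lra) (fun=> lexx _).
lra.
Qed.

(** The deviation of the optimum from [size w] is again a betting gain chosen with hindsight: bet on
    every bit if there are fewer true bits than big items, else on none. *)
Lemma opt_input_gain (p : R) m w : m%:R <= p * (size w)%:R ->
  (opt (input R m w))%:R <=
    (size w)%:R + gain p (fun=> (count id w < m)%N) w.
Proof.
move=> mp; have := opt_input_le m w; rewrite -(ler_nat R) => /le_trans; apply.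
have sw : size w = (count id w + count negb w)%N by rewrite -(count_predC id w).
rewrite (gain_count _ (f := fun=> (count id w < m)%N)) //.
case: ltnP => Lm /=.
  rewrite count_predT size_iota.
  have -> : count (nth false w) (iota 0 (size w)) = count id w.
    rewrite -[in RHS](mkseq_nth false w) /mkseq count_map.
    exact: eq_count.
  by rewrite {1}sw !natrD; lra.
by rewrite count_pred0 mulr0 subr0 addr0 sw.
Qed.

End Strategy.

Lemma ln_exp2_le (R : realType) n : ln ((2 ^ n)%:R : R) <= n%:R.
Proof.
rewrite natrX lnXn // -[leLHS]mulr_natr ler_piMl //.
by have := @le_ln1Dx R 1; apply; lra.
Qed.

Lemma sqrt2_bounds (R : realType) :
  [/\ Num.sqrt 2 ^+ 2 = 2 :> R, 1 < Num.sqrt 2 :> R & Num.sqrt 2 < 3 / 2 :> R].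
Proof.
have q2 : Num.sqrt 2 ^+ 2 = 2 :> R by rewrite sqr_sqrtr.
have q0 : 0 <= Num.sqrt 2 :> R := sqrtr_ge0 _.
by split=> //; nra.
Qed.

(** * Averaging over the hard inputs *)

Section AdviceBound.
Variables (R : realType) (b : nat -> nat) (M n : nat) (eta : R).
Hypotheses (eta0 : 0 < eta) (eta2 : eta <= 1 / 2) (Mn : (3 * M <= n)%N).

Let q : R := Num.sqrt 2.

(** The values maximizing [1 - p + 2 * theta] under [(1 - theta) * p = theta]. *)
Let p : R := q - 1.
Let theta : R := 1 - q / 2.
(** The mean number of true bits, rounded down: about one big item per true medium item. *)
Let m : nat := Num.truncn (p * M%:R).

Let p01 : 0 <= p <= 1.
Proof. by have [_ q1 q2] := sqrt2_bounds R; rewrite /p /q; apply/andP; split; lra. Qed.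

Let m_bounds : m%:R <= p * M%:R < m%:R + 1.
Proof.
have pM : 0 <= p * M%:R by case/andP: p01 => *; rewrite mulr_ge0.
by rewrite natr1; have := truncn_itv pM.
Qed.

Lemma Ex_cost_ge (A : det_alg R) : det_alg_with_advice A b ->
  (4 - 2 * q) * M%:R - 1 - ((b n)%:R / eta + 2 * eta * M%:R) <=
  Ex p M (fun w => (cost A (input R m w))%:R).
Proof.
move=> advA; have [qq q1 q2] := sqrt2_bounds R.
rewrite -/q in qq q1 q2.
have th01 : 0 <= theta <= 1 by rewrite /theta; apply/andP; split; lra.
have thp : (1 - theta) * p = theta.
  have -> : (1 - theta) * p = q ^+ 2 / 2 - q / 2 by rewrite /theta /p; field.
  by rewrite qq /theta; field.
(* The advice ranges over the [2 ^ b n] tuples, the finite family of strategies to which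
   [Ex_gain_le] applies. *)
pose tape w : (b n).-tuple bool :=
  Tuple (introT eqP (size_mkseq (da_oracle A (input R m w)) (b n))).
have mM : (m <= M)%N.
  case/andP: m_bounds => mp _; case/andP: p01 => _ p1.
  by rewrite -(ler_nat R) (le_trans mp) // ler_piMl.
have gain_le : Ex p M (fun w => gain p (opens A m (tape w)) w) <=
               (b n)%:R / eta + 2 * eta * M%:R.
  apply: le_trans (Ex_gain_le p01 eta0 eta2 M (fun a => opens A m (tval a)) tape) _.
  rewrite lerD2r ler_pM2r ?invr_gt0 //.
  by rewrite card_tuple card_bool ln_exp2_le.
pose lower w : R := (count negb w)%:R + ((theta * M%:R + (1 - theta) * m%:R) +
  - (1 - theta) * gain p (opens A m (tape w)) w).
have : Ex p M lower <= Ex p M (fun w => (cost A (input R m w))%:R).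
  apply: (le_Ex p01) => w sw.
  have sn : (size (input R m w) <= n)%N.
    have := count_size negb w; rewrite size_input; lia.
  have := cost_ge advA sn th01 thp.
  by rewrite /lower sw; apply: le_trans; rewrite mulNr !addrA.
apply: le_trans; rewrite /lower ExD ExD ExZ Ex_const Ex_count_false.
set G := Ex _ _ _ in gain_le *; set D := _ / eta + _ in gain_le *.
have e0 := ltW eta0.
have D0 : 0 <= D by rewrite addr_ge0 ?divr_ge0 ?mulr_ge0.
have th0 : 0 <= 1 - theta by case/andP: th01 => *; lra.
have h1 : (1 - theta) * G <= D.
  apply: le_trans (ler_wpM2l th0 gain_le) _.
  by rewrite ler_piMl //; case/andP: th01 => *; lra.
have /andP[_ /ltW mp] := m_bounds.
have {}mp := ler_wpM2l th0 mp; rewrite mulrA thp mulrDr mulr1 in mp.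
(* This is [1 - p + 2 * theta] per medium item; one [theta] comes from [(1 - theta) * m], whose
   rounding costs at most 1. *)
have -> : (4 - 2 * q) * M%:R = (1 - p) * M%:R + theta * M%:R + theta * M%:R.
  by rewrite /p /theta; field.
by case/andP: th01 => *; lra.
Qed.

(** Hindsight chooses between two strategies only, so [ln 2 <= 1] replaces the advice term. *)
Lemma Ex_opt_le : Ex p M (fun w => (opt (input R m w))%:R) <=
  M%:R + 1 / eta + 2 * eta * M%:R.
Proof.
have : Ex p M (fun w => (opt (input R m w))%:R) <=
       Ex p M (fun w => M%:R + gain p (fun=> (count id w < m)%N) w).
  apply: (le_Ex p01) => w sw; rewrite -sw; apply: opt_input_gain.
  by rewrite sw; case/andP: m_bounds.
move=> /le_trans; apply; rewrite ExD Ex_const -addrA lerD2l.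
apply: le_trans (Ex_gain_le p01 eta0 eta2 M (fun c _ => c)
  (fun w => (count id w < m)%N)) _.
by rewrite lerD2r ler_pM2r ?invr_gt0 // card_bool (ln_exp2_le R 1).
Qed.

Lemma advice_lower_bound (c alpha : R) (d : measure_display)
    (T : measurableType d) (P : probability T R) (alg : T -> det_alg R) :
  0 <= c -> randomized_alg_with_advice P alg b ->
  (forall s : seq R, valid_input s ->
    (\int[P]_w ((cost (alg w) s)%:R : R)%:E <= (c * (opt s)%:R + alpha)%:E)%E) ->
  (4 - 2 * q) * M%:R - 1 - ((b n)%:R / eta + 2 * eta * M%:R) <=
  c * (M%:R + 1 / eta + 2 * eta * M%:R) + alpha.
Proof.
move=> c0 [adv mcost] comp.
have [mEx iEx] := integral_Ex_le p01 M (fun w => mcost (input R m w))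
  (fun w t => ler0n R _) (fun w => comp _ (input_valid R m w)).
set L := leLHS.
(* The bound [L] may be negative; its maximum with 0 allows monotonicity of the integral for
   nonnegative functions. *)
have L_le : ((Num.max L 0)%:E <= \int[P]_t
    (Ex p M (fun w => (cost (alg t) (input R m w))%:R))%:E)%E.
  have <- : (\int[P]_t (cst (Num.max L 0)%:E t) = (Num.max L 0)%:E)%E.
    rewrite integral_cst //.
    by rewrite [X in (_ * X)%E](probability_setT P) mule1.
  apply: ge0_le_integral => //=.
  - by move=> t _; rewrite lee_fin le_max lexx orbT.
  - exact/measurable_EFinP.
  - move=> t _; rewrite lee_fin ge_max Ex_cost_ge //=.
    exact: (ge0_Ex p01).
have := le_trans L_le iEx; rewrite lee_fin ge_max => /andP[LE _].
apply: le_trans LE _; rewrite ExD ExZ Ex_const lerD2r.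
by rewrite ler_wpM2l // Ex_opt_le.
Qed.

End AdviceBound.

Theorem theorem4 (R : realType) (c : R) (hc : c < 4 - 2 * Num.sqrt 2)
  (d : measure_display) (T : measurableType d) (P : probability T R)
  (alg : T -> det_alg R) (b : nat -> nat)
  (halg : randomized_alg_with_advice P alg b)
  (hcomp : rand_competitive P alg c) :
  exists kappa : R, 0 < kappa /\
    exists N : nat, forall n : nat, (N <= n)%N -> kappa * n%:R <= (b n)%:R.
Proof.
have [alpha comp] := hcomp.
have [_ q1 q2] := sqrt2_bounds R.
(* The bound on the optimum is multiplied by the ratio, which must be nonnegative; raising it to 0
   keeps it below [4 - 2 * Num.sqrt 2]. *)
pose c' := Num.max c 0.
have c'0 : 0 <= c' by rewrite le_max lexx orbT.
have c'lt : c' < 4 - 2 * Num.sqrt 2 by rewrite gt_max hc /=; lra.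
have comp' s : valid_input s ->
    (\int[P]_w ((cost (alg w) s)%:R : R)%:E <= (c' * (opt s)%:R + alpha)%:E)%E.
  move=> /comp /le_trans; apply; rewrite lee_fin lerD2r ler_wpM2r //.
  by rewrite le_max lexx.
set g := 4 - 2 * Num.sqrt 2 - c'.
have g0 : 0 < g by rewrite /g; lra.
have g2 : g < 2 by rewrite /g; lra.
(* With [eta = g / 12] and [c' <= 2], the error [2 * eta * (1 + c') * M] is at most half of [g * M].
   Solving for [b n] with [M >= (n - 2) / 3] gives [b n >= g ^+ 2 / 72 * n - C], and large [n] makes
   [C] at most half of the linear term. *)
pose C := g ^+ 2 / 36 + g / 12 * (1 + alpha) + 2.
exists (g ^+ 2 / 144); split; first by rewrite divr_gt0 // exprn_gt0.
exists (Num.truncn `|C * 144 / g ^+ 2|).+1 => n Nn.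
have nC : C <= g ^+ 2 / 144 * n%:R.
  have : C * 144 / g ^+ 2 <= n%:R.
    apply: le_trans (ler_norm _) _; apply: ltW.
    by apply: lt_le_trans (truncnS_gt _) _; rewrite ler_nat.
  rewrite ler_pdivrMr ?exprn_gt0 //; lra.
(* A hard input has at most [3 * M] items, hence [M = n %/ 3]. *)
have Mn : (3 * (n %/ 3) <= n)%N by rewrite mulnC leq_trunc_div.
have nM : (n <= 3 * (n %/ 3) + 2)%N by lia.
have eta0 : 0 < g / 12 by rewrite divr_gt0.
have eta2 : g / 12 <= 1 / 2 by lra.
have := advice_lower_bound eta0 eta2 Mn c'0 halg comp'.
set M := (n %/ 3)%N in nM *; move: nM; rewrite -(ler_nat R) natrD natrM => nM H.
have M0 : 0 <= M%:R :> R by [].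
have {}H : g * M%:R - 2 * (g / 12) * (1 + c') * M%:R <=
    1 + alpha + ((b n)%:R + c') / (g / 12) by rewrite /g in H *; lra.
have c'2 : c' <= 2 by lra.
have {}H : M%:R * g / 2 - 1 - alpha <= ((b n)%:R + 2) / (g / 12).
  have h1 : ((b n)%:R + c') / (g / 12) <= ((b n)%:R + 2) / (g / 12).
    by rewrite ler_pM2r ?invr_gt0 // lerD2l.
  have h2 : 2 * (g / 12) * (1 + c') * M%:R <= 2 * (g / 12) * 3 * M%:R.
    by rewrite ler_wpM2r // ler_wpM2l; lra.
  lra.
move: H; rewrite ler_pdivlMr // => H.
have := ler_wpM2l (sqr_ge0 g) nM.
rewrite /C in nC; nra.
Qed.
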